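(* Let $d$ and $n$ be positive integers. There is a $q_1=q_1(d,n)>0$ such that for all prime powers $q\geq q_1$ with $q\equiv1\pmod d$, the following holds. Let $c_1,c_2,\ldots,c_n\in\mathbb{F}_q$ be pairwise distinct, let $C$ be the index $d$ subgroup of $\mathbb{F}_q^{\ast}$, let $M=\mathbb{F}_q^{\ast}/C$ be the set of all cosets of $C$ in $\mathbb{F}_q^{\ast}$, and let $s_1,s_2,\ldots,s_n$ be (arbitrary) functions $M\to M$. Then there is a first-order cyclotomic mapping $f$ of $\mathbb{F}_q$ of index $d$ such that for all $j=1,2,\ldots,n$ and all cosets $\mathcal{C}\in M$, one has $(f+c_j\operatorname{id})(\mathcal{C})=s_j(\mathcal{C})$ (equality of subsets of $\mathbb{F}_q^{\ast}$).
   Context: For a prime power $q$ and a divisor $d$ of $q-1$, let $C$ be the index $d$ subgroup of $\mathbb{F}_q^{\ast}$. A first-order cyclotomic mapping of $\mathbb{F}_q$ of index $d$ is a function $f:\mathbb{F}_q\to\mathbb{F}_q$ such that $f(0)=0$ and, for each coset $\mathcal{C}$ of $C$ in $\mathbb{F}_q^{\ast}$, there is a constant $a_{\mathcal{C}}\in\mathbb{F}_q$ with $f(x)=a_{\mathcal{C}}x$ for all $x\in\mathcal{C}$. The function $f+c\operatorname{id}$ is $x\mapsto f(x)+cx$, and $g(\mathcal{C})$ denotes the image of the set $\mathcal{C}$ under $g$. *)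

(* Defs.v *)
From HB Require Import structures.
From mathcomp Require Import all_boot all_order all_fingroup all_algebra all_solvable all_field.

Set Implicit Arguments.
Unset Strict Implicit.
Unset Printing Implicit Defensive.

Import GRing.Theory.
Local Open Scope ring_scope.

Definition index_subgroup (F : finFieldType) (d : nat) (C : {group {unit F}}) : bool :=
  #|[set: {unit F}] : C|%g == d.

Lemma index_subgroup_exists (F : finFieldType) (d : nat) :
  (0 < d)%N -> #|F| = 1 %[mod d] -> exists C : {group {unit F}}, index_subgroup d C.
Proof.
move=> d0 hq; have dv : (d %| #|[set: {unit F}]%g|)%N.
  rewrite card_finField_unit -subn1 -eqn_mod_dvd; first exact/eqP.
  by apply: ltnW; apply: finNzRing_gt1.
have cyc : cyclic [set: {unit F}]%g by apply: field_unit_group_cyclic.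
have [x Ex] := cyclicP cyc.
have ox : #|[set: {unit F}]%g| = #[x]%g by rewrite Ex.
rewrite ox in dv.
exists <[x ^+ d]>%G; rewrite /index_subgroup -divgS ?subsetT //= ox.
by rewrite [#|_|](orderXdiv dv) divnA // mulKn ?order_gt0.
Qed.

Lemma index_subgroup_unique (F : finFieldType) (d : nat) (C D : {group {unit F}}) :
  index_subgroup d C -> index_subgroup d D -> C = D.
Proof.
move=> /eqP hC /eqP hD.
have cyc : cyclic [set: {unit F}]%g by apply: field_unit_group_cyclic.
apply/val_inj/eqP => /=; rewrite (eq_subG_cyclic cyc) ?subsetT //.
have := LagrangeI [set: {unit F}]%G C; rewrite setTI hC => e1.
have := LagrangeI [set: {unit F}]%G D; rewrite setTI hD -e1 => /eqP.
by rewrite eqn_pmul2r 1?eq_sym // -hC indexg_gt0.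
Qed.

(* [coset_of C] consists of the cosets of C inside its normaliser; as {unit F}
   is abelian, these are all the cosets of C in the multiplicative group. *)
Definition coset_in (F : finFieldType) (C : {group {unit F}}) (K : coset_of C) : {set F} :=
  [set val u | u in (K : {set {unit F}})].

(* By [index_subgroup_unique] the witness C is the index d subgroup. *)
Definition first_order_cyclotomic (F : finFieldType) (d : nat) (f : F -> F) : Prop :=
  f 0 = 0 /\
  exists2 C : {group {unit F}}, index_subgroup d C &
    forall K : coset_of C, exists a : F, {in coset_in K, forall x, f x = a * x}.

(* Main.v *)
Require Import Defs.
From HB Require Import structures.
From mathcomp Require Import all_boot all_order all_fingroup all_algebra all_solvable all_field.
From mathcomp Require Import qpoly qfpoly zify.
From Stdlib Require Import Classical.

(* Every function of the form x |-> a_K x on the cosets K works as soon as each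
   a_K + c_j lies in a prescribed coset, that is (a_K + c_j)^m = z_j, where
   q = d m + 1.  Such points exist by Stepanov's method, applied to all j at once:
   with y_j = (X + c_j)^(q-m) one looks for a nonzero auxiliary polynomial
     P = sum_(e, k) h_(e,k) X^(q k) prod_j y_j^(e_j),   0 <= e_j < d, 0 <= k < K,
   with deg h_(e,k) < D, about q / d^n, vanishing to order M at the points counted.
   As y_j is proportional to X + c_j and X^q to X at these points, this costs only
   about M D linear conditions, so that any M < d^n K is allowed when q is large;
   the count is at most deg P / M, nearly q / d^n once K is large.  Since this
   holds for each of the d^n classes, none of them can be empty.

   The point is that P is nonzero.  Modulo X^q one has y_j^d = c_j^(d-1) (X + c_j),
   and the norm of sum_e h_e Y^e, as a determinant of small degree divisible by X^q,
   would vanish; so it suffices that the Y^e are linearly independent over F(X) when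
   Y_j^d is proportional to X + c_j.  This Kummer-type statement is proved by
   comparing a relation of minimal support with its image under Frobenius. *)

Set Implicit Arguments.
Unset Strict Implicit.
Unset Printing Implicit Defensive.

Import GRing.Theory.
Local Open Scope ring_scope.

(** * Multiplication matrices in the monomial basis *)

Section MonomialCombinations.
Variables (d0 n : nat).
Local Notation d := d0.+1.
Local Notation I := {ffun 'I_n -> 'I_d}.
Let ev (k : 'I_#|{: I}|) : I := enum_val k.

Definition monom (A : comNzRingType) (y : 'I_n -> A) (e : I) : A :=
  \prod_j y j ^+ e j.

Definition mcomb (A : comNzRingType) (y : 'I_n -> A) (a : I -> A) : A :=
  \sum_e a e * monom y e.

Definition carry (A : comNzRingType) (u : 'I_n -> A) (f e : I) : A :=
  \prod_j u j ^+ (d <= f j + e j)%N.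

Lemma monomM (A : comNzRingType) (u y : 'I_n -> A) (f e : I) :
  (forall j, y j ^+ d = u j) ->
  monom y f * monom y e = carry u f e * monom y (f + e).
Proof.
move=> yd; rewrite /monom /carry -!big_split /=; apply: eq_bigr => j _.
rewrite ffunE /= -exprD -yd -exprM -exprD; congr (_ ^+ _).
set k := (f j + e j)%N; have kd : (k < d + d)%N by have := ltn_ord (f j); have := ltn_ord (e j); lia.
case: leqP => hk /=; first by rewrite muln0 modn_small.
by rewrite muln1 -[X in (X %% _)%N](subnK hk) modnDr modn_small; lia.
Qed.

(* Multiplication by [\sum_e a e *: Y^e] in A[Y_j]/(Y_j^d - u_j), in the basis of
   monomials; exponents are added in Z/d, and [carry] collects the wrap-arounds. *)
Definition mul_matrix (A : comNzRingType) (u : 'I_n -> A) (a : I -> A) :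
    'M[A]_#|{: I}| :=
  \matrix_(i, k) (a (ev k - ev i) *
                  carry u (ev i) (ev k - ev i)).

Lemma mul_matrixP (A : comNzRingType) (u y : 'I_n -> A) (a : I -> A) i :
  (forall j, y j ^+ d = u j) ->
  \sum_k mul_matrix u a i k * monom y (ev k)
  = mcomb y a * monom y (ev i).
Proof.
move=> yd; set f := ev i; rewrite /mcomb mulr_suml.
rewrite (reindex_inj (subIr f)) /= (reindex ev) /=; last first.
  by apply: onW_bij; apply: enum_val_bij.
apply: eq_bigr => k _; rewrite !mxE -/f -!mulrA; congr (_ * _).
by rewrite [RHS]mulrC (monomM _ _ yd) [f + _]addrC subrK.
Qed.

Lemma map_mul_matrix (A A' : comNzRingType) (phi : {rmorphism A -> A'})
    (u : 'I_n -> A) (a : I -> A) :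
  map_mx phi (mul_matrix u a) = mul_matrix (phi \o u) (phi \o a).
Proof.
apply/matrixP => i k; rewrite !mxE rmorphM rmorph_prod; congr (_ * _).
by apply: eq_bigr => j _; rewrite rmorphXn.
Qed.

(** The column of all monomials lies in the kernel of the matrix. Multiplying by the adjugate and
    reading the entry of exponent 0, where the monomial is 1, isolates the determinant; zero
    divisors in [A] thus do no harm. *)
Lemma det_mul_matrix (A : comNzRingType) (u y : 'I_n -> A) (a : I -> A) :
  (forall j, y j ^+ d = u j) -> mcomb y a = 0 -> \det (mul_matrix u a) = 0.
Proof.
move=> yd a0; set M := mul_matrix u a.
have M0 : M *m (\col_k monom y (ev k)) = 0.
  apply/colP => i; rewrite !mxE.
  under eq_bigr => k _ do rewrite [X in _ * X]mxE.
  by rewrite (mul_matrixP _ _ yd) a0 mul0r.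
have /colP/(_ (enum_rank (0 : I))) : \adj M *m (M *m (\col_k monom y (ev k))) = 0.
  by rewrite M0 mulmx0.
rewrite mulmxA mul_adj_mx mul_scalar_mx !mxE /ev enum_rankK.
by rewrite /monom big1 ?mulr1 // => j _; rewrite ffunE.
Qed.

End MonomialCombinations.

(** * Field extensions containing prescribed roots *)

Lemma irreducible_factor (F : fieldType) (p : {poly F}) :
  (1 < size p)%N -> exists2 q, q %| p & monic_irreducible_poly q.
Proof.
have [k] := ubnP (size p); elim: k p => // k IH p ltpk p1.
have p0 : p != 0 by rewrite -size_poly_gt0 ltnW.
case: (classic (irreducible_poly p)) => [irr | nirr].
  exists ((lead_coef p)^-1 *: p); first by rewrite dvdpZl // invr_eq0 lead_coef_eq0.
  split; last by rewrite monicE lead_coefZ mulVf // lead_coef_eq0.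
  split; first by rewrite size_scale ?invr_eq0 ?lead_coef_eq0.
  move=> q q1; rewrite dvdpZr ?invr_eq0 ?lead_coef_eq0 // => qp.
  by rewrite (eqp_trans (irr.2 q q1 qp)) // eqp_sym eqp_scale // invr_eq0 lead_coef_eq0.
have [q [q1 qp nqp]] : exists q : {poly F}, [/\ size q != 1, q %| p & ~~ (q %= p)].
  apply: NNPP => H; apply: nirr; split=> // q q1 qp.
  by apply: contraT => nqp; case: H; exists q.
have q0 : q != 0 by apply: contraNneq p0 => q0; move: qp; rewrite q0 dvd0p.
have qlt : (size q < size p)%N.
  by rewrite ltn_neqAle dvdp_leq // andbT dvdp_size_eqp.
have [||r rq ri] := IH q; first exact: leq_trans qlt _.
  by rewrite ltn_neqAle eq_sym q1 size_poly_gt0.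
by exists r => //; apply: dvdp_trans qp.
Qed.

(** The class of ['X] modulo an irreducible factor of [p] is a root. *)
Lemma root_extension (F : fieldType) (p : {poly F}) : (1 < size p)%N ->
  exists (L : fieldType) (phi : {rmorphism F -> L}) (w : L), root (map_poly phi p) w.
Proof.
move=> /irreducible_factor[q /dvdpP[r ->] qi].
pose L : fieldType := {poly %/ q with qi}.
have phiP : monoid_morphism (qpolyC q : F -> L) by apply: qpolyC_is_monoid_morphism.
have phiA : zmod_morphism (qpolyC q : F -> L) by apply: qpolyC_is_zmod_morphism.
pose phiAM := GRing.isZmodMorphism.Build F L (qpolyC q : F -> L) phiA.
pose phiMM := GRing.isMonoidMorphism.Build F L (qpolyC q : F -> L) phiP.
pose phi : {rmorphism F -> L} := HB.pack (qpolyC q : F -> L) phiAM phiMM.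
exists L, phi, (in_qpoly q 'X).
rewrite /root rmorphM hornerM mulf_eq0; apply/orP; right.
apply/eqP; rewrite -[LHS](in_qpoly_comp_horner q q 'X) comp_polyXr.
by apply: val_inj; rewrite /= mk_monicE // Pdiv.Ring.rmodpp // /GRing.comm mulrC.
Qed.

Lemma radical_extension (K : fieldType) (d : nat) (us : seq K) : (0 < d)%N ->
  exists (L : fieldType) (phi : {rmorphism K -> L}),
    forall u, u \in us -> exists y, y ^+ d = phi u.
Proof.
move=> d0; elim: us => [|u us [L [phi IH]]].
  by exists K, idfun.
have [|L' [psi [w]]] := @root_extension L ('X^d - (phi u)%:P).
  by rewrite size_XnsubC.
rewrite rmorphB /= map_polyXn map_polyC rootE !hornerE subr_eq0 => /eqP wE.
exists L', (psi \o phi) => v; rewrite inE => /predU1P[->|/IH[y yE]]; first by exists w.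
by exists (psi y); rewrite -rmorphXn yE.
Qed.

(** * Frobenius, root multiplicities and independence of radicals *)

Lemma exp_card_sum (F : finFieldType) (L : comNzRingType) (phi : {rmorphism F -> L})
    (J : finType) (x : J -> L) :
  (\sum_j x j) ^+ #|F| = \sum_j x j ^+ #|F|.
Proof.
have [p pp Fp] := finPcharP F.
have Lp : p \in [pchar L] := rmorph_pchar phi Fp.
have qL : [pchar L].-nat #|F|.
  by rewrite (card_pprimeChar Fp) pnatX pnatE // Lp.
apply: (big_morph (fun z => z ^+ #|F|)) => [a b|]; first exact: exprDn_pchar.
by rewrite expr0n -leqn0 leqNgt (ltnW (finNzRing_gt1 F)).
Qed.

Lemma mupX (F : fieldType) (x : F) (p : {poly F}) k :
  p != 0 -> mup x (p ^+ k) = (k * mup x p)%N.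
Proof.
move=> p0; elim: k => [|k IH]; first by rewrite expr0 mupNroot ?root1.
by rewrite exprS mupM ?expf_neq0 // IH mulSn.
Qed.

Lemma mup_prod (F : fieldType) (x : F) (J : finType) (p : J -> {poly F}) :
  (forall j, p j != 0) -> mup x (\prod_j p j) = (\sum_j mup x (p j))%N.
Proof.
move=> p0.
have [_ ->] : (\prod_j p j != 0) /\ mup x (\prod_j p j) = (\sum_j mup x (p j))%N; last by [].
apply: (big_rec2 (fun a b => a != 0 /\ mup x a = b)).
  by rewrite oner_neq0 mupNroot ?root1.
by move=> j b a _ [a0 <-]; rewrite mulf_neq0 // mupM.
Qed.

Section Kummer.
Variables (F : finFieldType) (d0 n m : nat).
Local Notation d := d0.+1.
Local Notation I := {ffun 'I_n -> 'I_d}.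
Hypothesis cardF : #|F| = (d * m).+1.
Variables (a c : 'I_n -> F).
Hypothesis c_inj : injective c.
Hypothesis a_neq0 : forall j, a j != 0.

Let u j := a j *: ('X + (c j)%:P).

Lemma linear_neq0 j : u j != 0.
Proof. by rewrite scaler_eq0 (negPf (a_neq0 j)) -size_poly_gt0 size_XaddC. Qed.

Lemma mup_linear j k : mup (- c j) (u k) = (j == k).
Proof.
rewrite /u -mul_polyC mupMr ?rootC // -[c k]opprK polyCN -['X - _]expr1 mup_XsubCX.
by rewrite (inj_eq oppr_inj) (inj_eq c_inj) eq_sym; case: (j == k).
Qed.

Lemma mup_monom j (e : I) :
  mup (- c j) (monom (fun k => u k ^+ m) e) = (m * e j)%N.
Proof.
rewrite mup_prod => [|k]; last by rewrite !expf_neq0 ?linear_neq0.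
rewrite (bigD1 j) //= big1 ?addn0 => [|k kj].
  by rewrite !mupX ?expf_neq0 ?linear_neq0 // mup_linear eqxx muln1 mulnC.
by rewrite !mupX ?expf_neq0 ?linear_neq0 // mup_linear eq_sym (negPf kj) !muln0.
Qed.

(* The [q]-power Frobenius turns a relation with coefficients [h e] into one with
   coefficients [h e ^+ q * monom (u ^+ m) e]; a relation of minimal support is
   proportional to its image, which multiplicities at the [- c j] forbid. *)
Lemma monom_independent (L : fieldType) (phi : {rmorphism {poly F} -> L})
    (y : 'I_n -> L) (h : I -> {poly F}) :
  injective phi -> (forall j, y j ^+ d = phi (u j)) ->
  mcomb y (phi \o h) = 0 -> forall e, h e = 0.
Proof.
move=> phi_inj yd.
have phi_eq0 p : phi p = 0 -> p = 0 by move=> p0; apply: phi_inj; rewrite rmorph0.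
have y_neq0 (e : I) : monom y e != 0.
  apply/prodf_neq0 => j _; rewrite expf_neq0 //.
  apply/eqP => y0; have := linear_neq0 j; apply/negP; rewrite negbK.
  by apply/eqP/phi_eq0; rewrite -yd y0 expr0n.
have yq (e : I) : monom y e ^+ #|F| = phi (monom (fun k => u k ^+ m) e) * monom y e.
  rewrite rmorph_prod /monom -prodrXl -big_split /=; apply: eq_bigr => j _.
  rewrite !rmorphXn /= -yd cardF -!exprM -exprD; congr (_ ^+ _); lia.
have [k] := ubnP #|[pred e | h e != 0]|.
elim: k h => // k IH h lthk h0 e0; apply/eqP; apply: contraT => he0.
pose h2 e := h e ^+ #|F| * monom (fun k => u k ^+ m) e.
pose h3 e := h e0 * h2 e - h2 e0 * h e.
have h2_0 : mcomb y (phi \o h2) = 0.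
  transitivity (mcomb y (phi \o h) ^+ #|F|).
    rewrite (exp_card_sum (phi \o polyC)); apply: eq_bigr => e _.
    by rewrite /= /h2 exprMn rmorphM rmorphXn yq mulrA.
  by rewrite h0 expr0n cardF.
have h3_0 : mcomb y (phi \o h3) = 0.
  transitivity (phi (h e0) * mcomb y (phi \o h2) - phi (h2 e0) * mcomb y (phi \o h)).
    rewrite !mulr_sumr -sumrB; apply: eq_bigr => e _.
    by rewrite /= /h3 rmorphB !rmorphM mulrBl !mulrA.
  by rewrite h0 h2_0 !mulr0 subrr.
have h3E : forall e, h3 e = 0.
  apply: IH h3_0; rewrite -ltnS; apply: leq_trans lthk; rewrite ltnS.
  apply/proper_card/properP; split.
    apply/subsetP => e; rewrite !inE; apply: contra => /eqP he.
    by rewrite /h3 /h2 he cardF exprS !mul0r !mulr0 subrr.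
  by exists e0; rewrite !inE //= /h3 mulrC subrr eqxx.
have supp e : h e != 0 -> e = e0.
  move=> he; apply/ffunP => j; apply: val_inj => /=.
  have mon0 f : monom (fun k => u k ^+ m) f != 0.
    by apply/prodf_neq0 => i _; rewrite !expf_neq0 ?linear_neq0.
  have /eqP := h3E e; rewrite subr_eq0 => /eqP/(congr1 (mup (- c j))).
  rewrite !mupM ?mulf_neq0 ?expf_neq0 // !mup_monom !mupX // cardF.
  have := ltn_ord (e j); have := ltn_ord (e0 j).
  move: (mup _ (h e)) (mup _ (h e0)) (nat_of_ord (e j)) (nat_of_ord (e0 j)) => v w s t ltt lts.
  have m_gt0 : (0 < m)%N by have := finNzRing_gt1 F; rewrite cardF; case: (m); rewrite ?muln0.
  (* Cancelling [v + w] and then [m] leaves [d v + s = d w + t] with [s, t < d], so the two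
     exponents agree. *)
  move=> E; have {}E : (d * v + s = d * w + t)%N.
    by apply/eqP; rewrite -(eqn_pmul2l m_gt0); apply/eqP; lia.
  by rewrite -(modn_small lts) -(modn_small ltt) -(modnMDl v s) -(modnMDl w t) ![(_ * d)%N]mulnC E.
have := h0; rewrite /mcomb (bigD1 e0) //= big1 ?addr0 => [|e ee0].
  by move/eqP; rewrite mulf_eq0 (negPf (y_neq0 e0)) orbF => /eqP/phi_eq0/eqP; rewrite (negPf he0).
have [->|/supp E] := eqVneq (h e) 0; first by rewrite rmorph0 mul0r.
by rewrite E eqxx in ee0.
Qed.
End Kummer.

(** * Degree bounds and independence modulo ['X^#|F|] *)

Lemma size_prod_bound (R : nzRingType) (J : finType) (p : J -> {poly R}) s :
  (forall j, (size (p j) <= s.+1)%N) -> (size (\prod_j p j)%R <= (#|J| * s).+1)%N.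
Proof.
move=> ps; apply: leq_trans (size_poly_prod_leq _ _) _.
rewrite leq_subLR; apply: leq_trans (_ : (\sum_(j : J) s.+1).+1 <= _)%N.
  by rewrite ltnS leq_sum.
by rewrite sum_nat_const; change #|xpredT| with #|J|; lia.
Qed.

Lemma size_det_bound (R : comNzRingType) k (M : 'M[{poly R}]_k) s :
  (forall i j, (size (M i j) <= s.+1)%N) -> (size (\det M) <= (k * s).+1)%N.
Proof.
move=> Ms; apply: leq_trans (size_sum _ _ _) _; apply/bigmax_leqP => g _.
rewrite mulr_sign; set P := \prod_i _; have -> : size (if odd_perm g then - P else P) = size P by case: ifP; rewrite ?size_polyN.
by rewrite -[X in (X * s)%N]card_ord; apply: size_prod_bound.
Qed.

Lemma in_qpolyXn_eq0 (F : fieldType) q (p : {poly F}) : (0 < q)%N -> in_qpoly 'X^q p = 0 -> 'X^q %| p.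
Proof.
move=> q0 /(congr1 val) /=; rewrite mk_monic_Xn prednK //.
by rewrite -Pdiv.IdomainMonic.modpE ?monicXn // => /eqP.
Qed.

Lemma in_qpolyXn_mul (F : fieldType) q (p : {poly F}) : (0 < q)%N ->
  in_qpoly 'X^q (p * 'X^q) = 0.
Proof.
move=> q0; apply: val_inj; rewrite /= mk_monic_Xn prednK //.
by rewrite -Pdiv.IdomainMonic.modpE ?monicXn // modp_mull.
Qed.

Lemma XaddC_exp_card (F : finFieldType) (b : F) : ('X + b%:P) ^+ #|F| = 'X^#|F| + b%:P.
Proof.
have [p pp Fp] := finPcharP F.
rewrite exprDn_pchar; first by rewrite -rmorphXn expf_card.
rewrite (card_pprimeChar Fp) pnatX pnatE //.
by rewrite (@rmorph_pchar _ _ (polyC : {rmorphism F -> {poly F}}) _ Fp).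
Qed.

Section Independence.
Variables (F : finFieldType) (d0 n m : nat).
Local Notation d := d0.+1.
Local Notation I := {ffun 'I_n -> 'I_d}.
Hypothesis cardF : #|F| = (d * m).+1.
Variables (c : 'I_n -> F).
Hypothesis c_inj : injective c.
Hypothesis c_neq0 : forall j, c j != 0.

Let a j := c j ^+ d0.
Let u j := a j *: ('X + (c j)%:P).
Let r := (d0 * m).+1.
(* [r = #|F| - m]: this exponent, rather than [m], makes the [d]-th power of [lin_pow j]
   a polynomial [u j], not a fraction, modulo ['X^#|F|]. *)
Definition lin_pow j : {poly F} := ('X + (c j)%:P) ^+ r.

Let a_neq0 j : a j != 0. Proof. exact: expf_neq0. Qed.

Let phiq : {rmorphism {poly F} -> {poly %/ 'X^#|F|}} := in_qpoly 'X^#|F|.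

Lemma lin_powXd j : phiq (lin_pow j) ^+ d = phiq (u j).
Proof.
have cardF_gt0 : (0 < #|F|)%N by rewrite cardF.
(* With [q = #|F|], the power is [('X^q + c j)^d0 ('X + c j)], whose first factor is the constant
   [a j] modulo ['X^q]. *)
rewrite -rmorphXn -exprM; have -> : (r * d = #|F| * d0 + 1)%N by rewrite cardF /r; lia.
rewrite exprD exprM XaddC_exp_card expr1 rmorphM rmorphXn rmorphD /=.
have -> : phiq 'X^#|F| = 0.
  by apply: val_inj; rewrite /= mk_monic_Xn prednK // -Pdiv.IdomainMonic.modpE ?monicXn // modpp.
by rewrite add0r -rmorphXn -rmorphM /u -mul_polyC rmorphXn.
Qed.

(** The carry is a product of at most [n] linear polynomials, so it adds at most [n] to the
    degree. *)
Lemma size_mul_matrix (h : I -> {poly F}) s i k :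
  (forall e, (size (h e) <= s)%N) -> (size (mul_matrix u h i k) <= (s + n))%N.
Proof.
move=> hs; rewrite mxE; apply: leq_trans (size_polyMleq _ _) _.
rewrite -subn1 leq_subLR; apply: leq_trans (leq_add (hs _) (_ : _ <= n.+1)%N) _; last by lia.
apply: leq_trans (size_prod_bound (s := 1) _) _ => [j|]; last by rewrite card_ord muln1.
have := size_XaddC (c j); rewrite /u; case: (d <= _)%N => /= ss.
  by rewrite ?expr1 size_scale // ss.
by rewrite ?expr0 size_poly1.
Qed.

(** The determinant of multiplication by [h] is divisible by ['X^#|F|], and its degree bound is
    below [#|F|], so it is zero. A kernel row vector then gives a nonzero [w] whose product with [h]
    vanishes in a field containing the radicals. One factor vanishes there, and Kummer independence
    rules out that it is the one from [w]. *)
Lemma lin_pow_independent (h : I -> {poly F}) D :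
  (forall e, (size (h e) <= D)%N) -> (d ^ n * (D + n) <= #|F|)%N ->
  'X^#|F| %| mcomb lin_pow h -> forall e, h e = 0.
Proof.
move=> hD BD divh.
have cardF_gt0 : (0 < #|F|)%N by rewrite cardF.
have [D0|D_gt0] := posnP (D + n)%N.
  by move=> e; apply/eqP; rewrite -size_poly_eq0 -leqn0; apply: leq_trans (hD e) _; lia.
have cardI : #|{: I}| = (d ^ n)%N by rewrite card_ffun !card_ord.
have detM0 : \det (mul_matrix u h) = 0.
  have : 'X^#|F| %| \det (mul_matrix u h).
    apply: in_qpolyXn_eq0 => //.
    rewrite -[LHS]/(phiq _) -det_map_mx map_mul_matrix.
    apply: (det_mul_matrix (y := phiq \o lin_pow)) => [j|]; first exact: lin_powXd.
    case/dvdpP: divh => w wE.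
    transitivity (phiq (mcomb lin_pow h)).
      rewrite /mcomb rmorph_sum; apply: eq_bigr => e _.
      by rewrite rmorphM /monom rmorph_prod; congr (_ * _); apply: eq_bigr => j _; rewrite rmorphXn.
    by rewrite wE; apply: in_qpolyXn_mul.
  move=> dv; apply/eqP; apply: contraT => det0.
  have := dvdp_leq det0 dv; rewrite size_polyXn ltnNge => /negP[].
  apply: leq_trans BD.
  apply: leq_trans (size_det_bound (s := (D + n).-1) _) _ => [i k|].
    by rewrite prednK //; apply: size_mul_matrix.
  have : (0 < d ^ n)%N by rewrite expn_gt0.
  by rewrite cardI -[in (_ * (D + n))%N](prednK D_gt0) mulnS; lia.
have [L [psi rad]] := @radical_extension _ d (codom (@tofrac {poly F} \o u)) (ltn0Sn _).
pose phi : {rmorphism {poly F} -> L} := psi \o @tofrac {poly F}.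
have phi_inj : injective phi by move=> p q /fmorph_inj /eqP; rewrite tofrac_eq => /eqP.
have /fin_all_exists[y yd] : forall j, exists z : L, z ^+ d = phi (u j).
  by move=> j; apply: rad; apply: codom_f.
have /eqP/det0P[v v0 vM0] := detM0.
pose w (e : I) := v 0 (enum_rank e).
have : mcomb y (phi \o w) * mcomb y (phi \o h) = 0.
  pose ev (k : 'I_#|{: I}|) : I := enum_val k.
  rewrite {1}/mcomb (reindex ev) /=; last exact: onW_bij (@enum_val_bij _).
  rewrite mulr_suml.
  transitivity (\sum_i \sum_k phi (v 0 i * mul_matrix u h i k) * monom y (enum_val k : I)).
    apply: eq_bigr => i _; rewrite /w /ev enum_valK -mulrA [monom _ _ * _]mulrC.
    rewrite -(mul_matrixP (phi \o h) _ yd) mulr_sumr; apply: eq_bigr => k _.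
    have -> : mul_matrix (phi \o u) (phi \o h) i k = phi (mul_matrix u h i k).
      by rewrite -map_mul_matrix [LHS]mxE.
    by rewrite rmorphM -mulrA.
  rewrite exchange_big /= big1 // => k _; rewrite -mulr_suml -(rmorph_sum phi).
  by move/rowP/(_ k): vM0; rewrite mxE [RHS]mxE => E; rewrite E (rmorph0 phi) mul0r.
move/eqP; rewrite mulf_eq0 => /orP[] /eqP E; last exact: (monom_independent cardF c_inj a_neq0 phi_inj yd E).
have w0 := monom_independent cardF c_inj a_neq0 phi_inj yd E.
by case/eqP: v0; apply/rowP => i; rewrite mxE -(enum_valK i); apply: w0.
Qed.
End Independence.

(** * Stepanov's method: local expansions, auxiliary polynomials and the point bound *)

Lemma dvdp_Xn (F : fieldType) (p : {poly F}) k :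
  (forall i, (i < k)%N -> p`_i = 0) -> 'X^k %| p.
Proof.
move=> p0; rewrite -(poly_take_drop k p) [X in X + _](_ : _ = 0) ?add0r ?dvdp_mulIr //.
by apply/polyP => i; rewrite coef_take_poly coef0; case: ltnP => // /p0.
Qed.

Lemma coef_XaddC_exp (R : comNzRingType) (a : R) s i :
  (('X + a%:P) ^+ s)`_i = a ^+ (s - i) *+ 'C(s, i).
Proof.
rewrite addrC exprDn coef_sum.
under eq_bigr => k _ do rewrite -rmorphXn coefMn coefCM coefXn.
have [is_|si] := ltnP i s.+1.
  rewrite (bigD1 (Ordinal is_)) //= eqxx mulr1 big1 ?addr0 // => k ki.
  by rewrite [_ == _](negbTE _) ?mulr0 ?mul0rn // eq_sym; apply: contra ki => /eqP E; apply/eqP/val_inj.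
rewrite bin_small // mulr0n big1 // => k _.
by rewrite [_ == _](negbTE _) ?mulr0 ?mul0rn // gtn_eqF // (leq_trans (ltn_ord k)).
Qed.

Lemma dvdp_prod_XsubC_exp (F : fieldType) (s : seq F) k (p : {poly F}) : uniq s ->
  (forall x, x \in s -> ('X - x%:P) ^+ k %| p) -> \prod_(x <- s) ('X - x%:P) ^+ k %| p.
Proof.
elim: s => [|x s IH] /=; first by rewrite big_nil dvd1p.
case/andP=> xs us sp; rewrite big_cons Gauss_dvdp.
  by rewrite sp ?mem_head // IH // => y ys; apply: sp; rewrite inE ys orbT.
apply: coprimep_expl; rewrite coprimep_sym coprimep_XsubC /root horner_prod prodf_seq_neq0.
apply/allP => y ys /=; rewrite horner_exp expf_neq0 // hornerXsubC subr_eq0.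
by apply: contraNneq xs => ->.
Qed.

Section Stepanov.
Variables (F : finFieldType) (d0 n m : nat).
Local Notation d := d0.+1.
Local Notation I := {ffun 'I_n -> 'I_d}.
Hypothesis cardF : #|F| = (d * m).+1.
Variables (c z : 'I_n -> F).
Hypothesis c_inj : injective c.
Hypothesis c_neq0 : forall j, c j != 0.
Hypothesis z_neq0 : forall j, z j != 0.
Variables (K D M : nat).
Hypothesis M_gt0 : (0 < M)%N.
Hypothesis M_le : (M <= #|F|)%N.
Hypothesis D_le : (d ^ n * (D + n) <= #|F|)%N.

Let q := #|F|.
Let r := (d0 * m).+1.
Local Notation G := {ffun I * 'I_K -> 'rV[F]_D}.
Implicit Types (h : G) (e : I) (k : 'I_K).

Definition coset_points : {set F} := [set x | [forall j, (x + c j) ^+ m == z j]].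

Definition aux_poly h : {poly F} :=
  \sum_ek rVpoly (h ek) * 'X^(q * ek.2) * monom (lin_pow d0 m c) ek.1.

(* In {poly {poly F}} the outer variable is the point x and the inner one the
   increment T: up to the nonzero factor [(x + c j) ^+ M] this is the expansion
   modulo T^M of [lin_pow j ^+ i] at x + T, for x in [coset_points]. *)
Definition local_factor j i : {poly {poly F}} :=
  ((z j)^-1%:P%:P * ('X + (c j)%:P%:P)) ^+ i *
  \sum_(l < M) ('X^l)%:P * ('X + (c j)%:P%:P) ^+ (M - l) *+ 'C(r * i, l).

(** Here ['X^(q * k)] has become ['X^k], since [(x + T)^q = x + T^q] is [x] modulo [T^M] when
    [M <= q]. Asking the coefficients of low order in [T] to vanish as polynomials in [x] treats all
    points at once. *)
Definition local_form h : {poly {poly F}} :=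
  \sum_ek (map_poly polyC (rVpoly (h ek)) \Po ('X + 'X%:P)) * 'X^(ek.2) *
          \prod_j local_factor j (ek.1 j).

Lemma mem_coset_points x j : x \in coset_points ->
  x + c j != 0 /\ (x + c j) ^+ r = (z j)^-1 * (x + c j).
Proof.
rewrite inE => /forallP/(_ j)/eqP xz.
have m_gt0 : (0 < m)%N.
  by move: (finNzRing_gt1 F); rewrite cardF; case: (m) => //; rewrite muln0.
have x0 : x + c j != 0.
  by apply: contraNneq (z_neq0 j) => x0; rewrite -xz x0 expr0n -leqn0 leqNgt m_gt0.
split=> //; apply: (mulfI (z_neq0 j)); rewrite mulrA mulfV // mul1r -xz -exprD.
have -> : (m + r = #|F|)%N by rewrite cardF /r; lia.
exact: expf_card.
Qed.

Lemma local_factorP x j i (rho : {rmorphism {poly F} -> {poly %/ 'X^M}} := in_qpoly 'X^M) :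
  x \in coset_points ->
  rho (local_factor j i).[x%:P]
  = rho (((x + c j) ^+ M)%:P * (lin_pow d0 m c j \Po ('X + x%:P)) ^+ i).
Proof.
move=> /(mem_coset_points j)[]; set al := x + c j => al0 alr.
apply/eqP; rewrite -subr_eq0 -rmorphB; apply/eqP.
suff /dvdpP[w ->] : 'X^M %| (local_factor j i).[x%:P] -
    (al ^+ M)%:P * (lin_pow d0 m c j \Po ('X + x%:P)) ^+ i.
  exact: in_qpolyXn_mul.
have -> : (local_factor j i).[x%:P] =
   (al ^+ (r * i))%:P * \sum_(l < M) 'X^l * (al ^+ (M - l))%:P *+ 'C(r * i, l).
  rewrite hornerM horner_exp hornerM hornerC hornerD hornerX hornerC -rmorphD -/al.
  rewrite -rmorphM -alr -rmorphXn -exprM; congr (_ * _).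
  rewrite horner_sum; apply: eq_bigr => l _.
  by rewrite hornerMn hornerM hornerC horner_exp hornerD hornerX hornerC -rmorphD -rmorphXn.
have -> : lin_pow d0 m c j \Po ('X + x%:P) = ('X + al%:P) ^+ r.
  by rewrite /lin_pow rmorphXn /= rmorphD /= comp_polyX comp_polyC -addrA -rmorphD.
rewrite -exprM; apply: dvdp_Xn => l lM.
rewrite coefB !coefCM coef_XaddC_exp coef_sum (bigD1 (Ordinal lM)) //= big1 ?addr0 => [|k kl].
  rewrite coefMn coefMC coefXn eqxx mul1r !mulrnAr -!exprD.
  (* For [l > r * i] the binomial coefficient makes both sides zero; otherwise both powers of [al]
     have exponent [r i + M - l]. *)
  have [lr|/bin_small->] := leqP l (r * i); last by rewrite !mulr0n subrr.
  by rewrite addnC addnBAC ?(ltnW lM) // addnBA // addnC subrr.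
rewrite coefMn coefMC coefXn [_ == _](negbTE _) ?mul0r ?mul0rn //.
by rewrite eq_sym; apply: contra kl => /eqP E; apply/eqP/val_inj.
Qed.

(** Modulo ['X^M], the value of [local_form h] at [x] is the translate of [aux_poly h] by [x], times
    the nonzero constant [C]. Translating back turns divisibility by ['X^M] into multiplicity at
    [x]. *)
Lemma local_formP x h : x \in coset_points ->
  'X^M %| (local_form h).[x%:P] -> ('X - x%:P) ^+ M %| aux_poly h.
Proof.
move=> xS divW.
pose rho : {rmorphism {poly F} -> {poly %/ 'X^M}} := in_qpoly 'X^M.
pose C := \prod_j (x + c j) ^+ M.
have C0 : C != 0.
  by apply/prodf_neq0 => j _; rewrite expf_neq0 //; have [] := mem_coset_points j xS.
have rhoX : rho ('X^q \Po ('X + x%:P)) = rho x%:P.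
  rewrite rmorphXn /= comp_polyX XaddC_exp_card rmorphD /=.
  rewrite [X in X + _](_ : _ = 0) ?add0r // -(subnK M_le) exprD.
  exact: in_qpolyXn_mul.
have : rho (C%:P * (aux_poly h \Po ('X + x%:P))) = 0.
  transitivity (rho (local_form h).[x%:P]); last first.
    case/dvdpP: divW => w ->.
    exact: in_qpolyXn_mul.
  rewrite /aux_poly /local_form raddf_sum horner_sum mulr_sumr !rmorph_sum.
  apply: eq_bigr => -[e k] _ /=.
  rewrite !hornerM horner_prod hornerXn horner_comp hornerD hornerX hornerC.
  rewrite !rmorphM exprM rmorphXn [rho _ * (_ * _)]mulrC -!mulrA; congr (_ * _).
    by congr (rho _); rewrite [x%:P + _]addrC.
  rewrite /= [rho (_ ^+ k)]rmorphXn rhoX -rmorphXn /=.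
  rewrite -[rho (x%:P ^+ k)]/(rho _); congr (_ * _).
  transitivity (rho (\prod_j (((x + c j) ^+ M)%:P * (lin_pow d0 m c j \Po ('X + x%:P)) ^+ e j))).
    rewrite big_split /= [RHS]rmorphM mulrC; congr (_ * rho _); first by rewrite /C rmorph_prod.
    by rewrite /monom rmorph_prod; apply: eq_bigr => j _; rewrite rmorphXn.
  by rewrite !rmorph_prod; apply: eq_bigr => j _; rewrite -local_factorP.
move/in_qpolyXn_eq0 => /(_ M_gt0); rewrite mul_polyC dvdpZr // => /dvdpP[w wE].
have -> : aux_poly h = (aux_poly h \Po ('X + x%:P)) \Po ('X - x%:P).
  by rewrite -comp_polyA rmorphD /= comp_polyX comp_polyC subrK comp_polyXr.
by rewrite wE rmorphM /= rmorphXn /= comp_polyX dvdp_mulIr.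
Qed.

Lemma local_form_zmod : zmod_morphism local_form.
Proof.
move=> h1 h2; rewrite /local_form -sumrB; apply: eq_bigr => ek _.
by rewrite !ffunE !raddfB /= !mulrBl.
Qed.

Lemma size_local_factor j i : (i <= d0)%N ->
  (size (local_factor j i) <= (d0 + M).+1)%N.
Proof.
move=> id; have sz := size_XaddC (c j)%:P.
have powS (p : {poly {poly F}}) (t : nat) : (size p <= 2)%N -> (size (p ^+ t) <= t.+1)%N.
  move=> p2; apply: leq_trans (size_poly_exp_leq _ _) _; rewrite ltnS.
  by case: (size p) p2 => [|[|[|]]] //= _; rewrite ?mul0n ?mul1n.
apply: leq_trans (size_polyMleq _ _) _.
have s1 : (size (((z j)^-1%:P%:P * ('X + (c j)%:P%:P)) ^+ i)%R <= d0.+1)%N.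
  apply: leq_trans (powS _ _ _) _ => //; rewrite mul_polyC.
  by apply: leq_trans (size_scale_leq _ _) _; rewrite sz.
have s2 : (size (\sum_(l < M) ('X^l)%:P * ('X + (c j)%:P%:P) ^+ (M - l) *+ 'C(r * i, l))%R <= M.+1)%N.
  apply: leq_trans (size_sum _ _ _) _; apply/bigmax_leqP => l _.
  rewrite -mulr_natl -polyC_natr mul_polyC; apply: leq_trans (size_scale_leq _ _) _.
  rewrite mul_polyC; apply: leq_trans (size_scale_leq _ _) _.
  by apply: leq_trans (powS _ _ _) _; rewrite ?sz // ltnS leq_subr.
by move: (leq_add s1 s2); case: (_ + _)%N => [|k] /=; lia.
Qed.

(** The size is taken in the outer variable. The large exponents [q] and [r] no longer enter it, so
    it exceeds [D] only by a term free of [#|F|]. *)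
Lemma size_local_form h : (size (local_form h) <= D + K + n * (d0 + M))%N.
Proof.
apply: leq_trans (size_sum _ _ _) _; apply/bigmax_leqP => -[e k] _ /=.
apply: leq_trans (size_polyMleq _ _) _.
have s1 : (size (\prod_j local_factor j (e j))%R <= (n * (d0 + M)).+1)%N.
  rewrite -[n in (n * _)%N]card_ord; apply: size_prod_bound => j.
  by rewrite size_local_factor // -ltnS.
have s2 : (size ((map_poly polyC (rVpoly (h (e, k))) \Po ('X + 'X%:P)) * 'X^k)%R <= D + K)%N.
  apply: leq_trans (size_polyMleq _ _) _; rewrite size_polyXn addnS /=.
  rewrite leq_add ?(ltnW (ltn_ord k)) // size_comp_poly2 ?size_XaddC //.
  by rewrite size_map_polyC size_poly.
by move: (leq_add s2 s1); case: (_ + _)%N => [|i] /=; lia.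
Qed.

Lemma size_aux_poly h : (0 < K)%N -> (size (aux_poly h) <= q * (K + n * d0))%N.
Proof.
move=> K_gt0; apply: leq_trans (size_sum _ _ _) _; apply/bigmax_leqP => -[e k] _ /=.
have q_gt0 : (0 < q)%N by rewrite /q cardF.
have rq : (r <= q)%N by rewrite /q cardF /r; lia.
have s1 : (size (monom (lin_pow d0 m c) e) <= (q * (n * d0)).+1)%N.
  apply: leq_trans (size_prod_bound (s := q * d0) _) _ => [j|]; last by rewrite card_ord; lia.
  apply: leq_trans (size_poly_exp_leq _ _) _; rewrite ltnS leq_mul //; last by rewrite -ltnS.
  by rewrite /lin_pow -[c j]opprK polyCN size_exp_XsubC.
have s2 : (size (rVpoly (h (e, k)) * 'X^(q * k))%R <= q * K)%N.
  apply: leq_trans (size_polyMleq _ _) _; rewrite size_polyXn addnS /=.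
  have Dq : (D <= q)%N.
    apply: leq_trans D_le; apply: leq_trans (leq_addr n D) _.
    by rewrite leq_pmull // expn_gt0.
  apply: leq_trans (leq_add (leq_trans (size_poly _ _) Dq) (leqnn _)) _.
  by rewrite -mulnS leq_mul.
apply: leq_trans (size_polyMleq _ _) _.
by move: (leq_add s2 s1); case: (_ + _)%N => [|i] /=; lia.
Qed.

(** Strong induction on [k]: coefficients of index below [k] vanish and those above contribute
    multiples of ['X^(q * k.+1)]. Hence ['X^q] divides the combination at [k], to which independence
    applies. *)
Lemma aux_poly_eq0 h : aux_poly h = 0 -> h = 0.
Proof.
move=> h0; suff H k e : h (e, k) = 0 by apply/ffunP => -[e k]; rewrite H ffunE.
have [i] := ubnP (nat_of_ord k); elim: i k e => // i IH k e; rewrite ltnS => ki.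
rewrite -[LHS]rVpolyK; rewrite (_ : rVpoly _ = 0) ?linear0 //.
apply: (lin_pow_independent cardF c_inj c_neq0 (h := fun e => rVpoly (h (e, k))) (D := D)) => //.
  by move=> f; apply: size_poly.
have q_gt0 : (0 < q)%N by rewrite /q cardF.
have E : aux_poly h = \sum_l mcomb (lin_pow d0 m c) (fun e => rVpoly (h (e, l))) * 'X^(q * l).
  rewrite /mcomb (eq_bigr _ (fun l _ => mulr_suml _ _ _ _)) exchange_big pair_big /=.
  by apply: eq_bigr => -[f l] _ /=; rewrite mulrAC.
have : 'X^(q * k) * 'X^q %| mcomb (lin_pow d0 m c) (fun e => rVpoly (h (e, k))) * 'X^(q * k).
  move: E; rewrite h0 (bigD1 k) //= => /esym/eqP; rewrite addr_eq0 => /eqP ->.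
  rewrite dvdpNr; apply: (big_ind (fun p => _ %| p)) => [||l lk]; [exact: dvdp0 | exact: dvdp_add |].
  have [kl|lk'] := ltnP k l.
    apply: dvdp_mull; rewrite -exprD -mulnSr -(subnK (leq_mul (leqnn q) kl)) exprD.
    by rewrite dvdp_mulIr.
  rewrite /mcomb big1 ?mul0r ?dvdp0 // => f _; rewrite IH ?linear0 ?mul0r //.
  by apply: leq_trans ki; rewrite ltn_neqAle lk' andbT.
by rewrite mulrC dvdp_mul2r // -size_poly_gt0 size_polyXn.
Qed.

(** Pigeonhole: there are more choices of [h] than values of the conditions, so two choices collide,
    and their difference is a solution because [local_form] is additive. *)
Lemma exists_local_form0 : (M * (D + K + n * (d0 + M)) < D * (d ^ n * K))%N ->
  exists2 h, h != 0 & forall i l, (l < M)%N -> (local_form h)`_i`_l = 0.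
Proof.
set E := (D + K + n * (d0 + M))%N => lt.
pose cond h : {ffun 'I_E -> 'rV[F]_M} := [ffun i : 'I_E => poly_rV (local_form h)`_i].
have ninj : ~ injective cond.
  move=> /leq_card; apply/negP; rewrite -ltnNge !card_ffun !card_mx card_prod card_ffun !card_ord.
  by rewrite !mul1n -!expnM ltn_exp2l ?finNzRing_gt1.
have [h1 [h2 [h12 E12]]] : exists h1 h2, h1 <> h2 /\ cond h1 = cond h2.
  apply: NNPP => H; apply: ninj => h1 h2 E12.
  by apply: NNPP => h12; apply: H; exists h1, h2.
exists (h1 - h2); first by rewrite subr_eq0; apply/eqP.
move=> i l lM; rewrite local_form_zmod.
have := size_local_form h1; have := size_local_form h2; rewrite -/E.
have : forall t : 'I_E, poly_rV (local_form h1)`_t = poly_rV (local_form h2)`_t :> 'rV_M.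
  by move=> t; have := congr1 (fun g : {ffun 'I_E -> 'rV[F]_M} => g t) E12; rewrite !ffunE.
move: (local_form h1) (local_form h2) => p1 p2 p12 s2 s1; rewrite !coefB.
have [iE|Ei] := ltnP i E; last by rewrite !(nth_default _ (leq_trans _ Ei)) ?coef0 ?subrr.
by have /rowP/(_ (Ordinal lM)) := p12 (Ordinal iE); rewrite !mxE /= => ->; rewrite subrr.
Qed.

Lemma card_coset_points : (0 < K)%N ->
  (M * (D + K + n * (d0 + M)) < D * (d ^ n * K))%N ->
  (M * #|coset_points| < q * (K + n * d0))%N.
Proof.
move=> K_gt0 /exists_local_form0[h h0 hW].
have P0 : aux_poly h != 0 by apply: contraNneq h0 => /aux_poly_eq0 ->.
apply: leq_trans (size_aux_poly h K_gt0).
have : \prod_(x <- enum coset_points) ('X - x%:P) ^+ M %| aux_poly h.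
  apply: dvdp_prod_XsubC_exp; first exact: enum_uniq.
  move=> x; rewrite mem_enum => xS; apply: local_formP => //.
  rewrite horner_coef; apply: (big_ind (fun p => _ %| p)) => [||i _]; [exact: dvdp0 | exact: dvdp_add |].
  by apply: dvdp_mulr; apply: dvdp_Xn => l; apply: hW.
move/(dvdp_leq P0); rewrite size_prod_seq => [|x _]; last by rewrite expf_neq0 // polyXsubC_eq0.
under eq_bigr => x _ do rewrite size_exp_XsubC.
by rewrite big_const_seq count_predT iter_addn_0 -cardE mulSn -addSn addSnnS addKn.
Qed.

End Stepanov.

(** * Counting points in the classes *)

Lemma card_unity_roots (F : finFieldType) k :
  (0 < k)%N -> (#|[set w : F | w ^+ k == 1%R]%SET| <= k)%N.
Proof.
move=> k_gt0; rewrite cardE; apply: max_unity_roots (enum_uniq _) => //.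
by apply/allP => w; rewrite mem_enum inE unity_rootE.
Qed.

(** Translating by [b] reduces to nonzero constants [c j], for which the scalars [c j ^+ d0] in the
    Kummer relations are invertible. *)
Lemma exists_avoiding_shift (F : finFieldType) n (c : 'I_n -> F) :
  (n < #|F|)%N -> exists b, forall j, c j + b != 0.
Proof.
move=> nq; have /subsetPn[b _ bc] : ~~ ([set: F] \subset [set - c j | j : 'I_n]).
  apply: contraL nq => /subset_leq_card; rewrite cardsT -leqNgt => /leq_trans; apply.
  by rewrite -[X in (_ <= X)%N]card_ord leq_imset_card.
exists b => j; apply: contraNneq bc => /eqP; rewrite addr_eq0 => /eqP cb.
by apply/imsetP; exists j; rewrite // cb opprK.
Qed.

Lemma card_bigcup_leq (T J : finType) (W : {set J}) (A : J -> {set T}) :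
  (#|\bigcup_(i in W) A i| <= \sum_(i in W) #|A i|)%N.
Proof.
apply: (big_ind2 (fun (X : {set T}) k => (#|X| <= k)%N)) => //; first by rewrite cards0.
move=> X k Y l Xk Yl; apply: leq_trans (leq_card_setU X Y).1 _; exact: leq_add.
Qed.

Section Counting.
Variables (d0 n : nat).
Local Notation d := d0.+1.
Let B := (d ^ n)%N.
(* [M = B K - 1] leaves [D] conditions of slack, and [K] is large enough for
   [(B - 1) (K + n d0) < M], so that [B - 1] classes cannot cover all points. *)
Let K := (B * (n * d0) + 2)%N.
Let M := (B * K).-1.
Let T := (M * (K + n * (d0 + M)))%N.

(** The summand [B * (T + n).+1] gives [T < D] for [D = q %/ B - n]; the others give [M <= q],
    [M * n < q] and [n < q]. *)
Definition threshold := (B * (T + n).+1 + M * n + M + n).+1.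

(** If the class of [z] were empty, at most [B - 1] other classes would cover every [x] outside the
    points [- c j]. Stepanov's bound for each class would give [M (q - n) <= (B - 1) q (K + n d0)],
    against the choice of [K] and [M]. *)
Lemma exists_point_nonzero (F : finFieldType) m (c z : 'I_n -> F) :
  (threshold <= #|F|)%N -> #|F| = (d * m).+1 -> injective c ->
  (forall j, c j != 0) -> (forall j, z j ^+ d = 1) ->
  exists x, forall j, (x + c j) ^+ m = z j.
Proof.
move=> qlarge cardF c_inj c_neq0 zd; apply: NNPP => noz.
set q := #|F| in qlarge cardF.
have B_gt0 : (0 < B)%N by rewrite expn_gt0.
have M_gt0 : (0 < M)%N by rewrite /M /K; nia.
have m_gt0 : (0 < m)%N by move: (finNzRing_gt1 F); rewrite -/q cardF; case: (m) => //; rewrite muln0.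
(* The largest [D] with [B (D + n) <= q]. *)
pose D := (q %/ B - n)%N.
have D_large : (T < D)%N.
  rewrite /D ltn_subRL leq_divRL // mulnC addnC.
  by apply: leq_trans qlarge; rewrite /threshold; lia.
have D_le : (B * (D + n) <= q)%N.
  rewrite subnK; first by rewrite mulnC leq_trunc_div.
  by apply: ltnW; rewrite -subn_gt0; apply: leq_ltn_trans D_large.
have bound (w : {ffun 'I_n -> F}) : (forall j, w j ^+ d = 1) ->
    (M * #|coset_points m c w| <= q * (K + n * d0))%N.
  move=> wd; apply: ltnW; apply: (card_coset_points cardF c_inj c_neq0 _ M_gt0 _ D_le) => //.
  - move=> j; apply/eqP => wj0; have := wd j; rewrite wj0 expr0n => /eqP.
    by rewrite eq_sym oner_eq0.
  - by rewrite -/q; apply: leq_trans qlarge; rewrite /threshold; lia.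
  - by rewrite /K; lia.
  (* As [B K = M + 1], the inequality reduces to [T < D]. *)
  rewrite -/B; have -> : (B * K = M.+1)%N by rewrite /M; nia.
  by rewrite mulnS -addnA mulnDr [(D * M)%N]mulnC addnC ltn_add2r.
pose zf : {ffun 'I_n -> F} := [ffun j => z j].
pose W : {set {ffun 'I_n -> F}} := [set w in ffun_on (mem [set w : F | w ^+ d == 1])].
have cardW : (#|W| <= B)%N.
  rewrite cardsE card_ffun_on card_ord /B; case: (n) => // k.
  by rewrite leq_exp2r ?card_unity_roots.
have zW : zf \in W.
  by rewrite inE; apply/ffun_onP => j; rewrite !inE ffunE zd.
pose U := ~: [set - c j | j : 'I_n].
have cardU : (q - n <= #|U|)%N.
  rewrite cardsCs setCK leq_sub2l //.
  by rewrite -[X in (_ <= X)%N]card_ord leq_imset_card.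
have subU : U \subset \bigcup_(w in W :\ zf) coset_points m c w.
  apply/subsetP => x; rewrite inE => xU.
  apply/bigcupP; exists [ffun j => (x + c j) ^+ m]; last first.
    by rewrite inE; apply/forallP => j; rewrite ffunE.
  rewrite !inE; apply/andP; split.
    apply/eqP => E; apply: noz; exists x => j.
    by move/ffunP/(_ j): E; rewrite !ffunE.
  apply/ffun_onP => j; rewrite !inE ffunE -exprM mulnC.
  have x0 : x + c j != 0.
    by apply: contraNneq xU => /eqP; rewrite addr_eq0 => /eqP ->; apply: imset_f.
  by apply/eqP/(mulfI x0); rewrite mulr1 -exprS -cardF expf_card.
have : (M * (q - n) <= B.-1 * (q * (K + n * d0)))%N.
  apply: leq_trans (leq_mul (leqnn M) (leq_trans cardU (subset_leq_card subU))) _.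
  have cardWz : (#|W :\ zf| <= B.-1)%N by rewrite -ltnS prednK //; move: cardW; rewrite (cardsD1 zf) zW.
  apply: leq_trans (leq_mul cardWz (leqnn _)).
  apply: leq_trans (leq_mul (leqnn M) (card_bigcup_leq _ _)) _.
  rewrite big_distrr -sum_nat_const leq_sum // => w; rewrite !inE => /andP[_ /ffun_onP wW].
  by apply: bound => j; have := wW j; rewrite inE => /eqP.
apply/negP; rewrite -ltnNge.
(* Thus [M q] exceeds [(B - 1) q (K + n d0)] by [(n d0 + 1) q], more than the loss [M n] due to the
   points [- c j]. *)
have ME : (M = B.-1 * (K + n * d0) + (n * d0).+1)%N by rewrite /M /K -(prednK B_gt0) /=; move: B.-1 (n * d0)%N => b X; lia.
have qMn : (M * n < q)%N by apply: leq_trans qlarge; rewrite /threshold; lia.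
rewrite mulnBr ltn_subRL [ltnRHS](_ : _ = B.-1 * (q * (K + n * d0)) + (n * d0).+1 * q)%N.
  by rewrite addnC ltn_add2l (leq_trans qMn) // leq_pmull.
by rewrite {1}ME mulnDl -mulnA [(q * _)%N]mulnC.
Qed.

Lemma exists_point (F : finFieldType) m (c z : 'I_n -> F) :
  (threshold <= #|F|)%N -> #|F| = (d * m).+1 -> injective c ->
  (forall j, z j ^+ d = 1) -> exists x, forall j, (x + c j) ^+ m = z j.
Proof.
move=> qlarge cardF c_inj zd.
have [|b cb] := @exists_avoiding_shift F n c.
  by apply: leq_trans qlarge; rewrite /threshold ltnS leq_addl.
have [|x xP] := exists_point_nonzero qlarge cardF _ cb zd; first by move=> i j /addIr/c_inj.
by exists (x + b) => j; rewrite -xP -addrA [b + _]addrC.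
Qed.

End Counting.

(** * Cosets in the multiplicative group *)

Section Cosets.
Variables (F : finFieldType) (C : {group {unit F}}).
Implicit Types (u v w : {unit F}) (L : coset_of C).

Lemma in_norm_unit u : u \in 'N(C)%g.
Proof.
have abF : abelian [set: {unit F}]%g by apply/cyclic_abelian/field_unit_group_cyclic.
by apply: (subsetP (sub_abelian_norm abF (subsetT _))); rewrite inE.
Qed.

Lemma mem_coset_unit u L : (u \in (L : {set {unit F}})) = (coset C u == L).
Proof.
apply/idP/eqP => [/coset_mem //|<-].
by rewrite val_coset ?in_norm_unit // rcoset_refl.
Qed.

Lemma coset_unitM u v : coset C (u * v)%g = (coset C u * coset C v)%g.
Proof. by rewrite morphM ?in_norm_unit. Qed.

Lemma coset_unitV u : coset C u^-1%g = (coset C u)^-1%g.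
Proof. exact: morphV (in_norm_unit u). Qed.

(** [C] has order [m], so its elements are roots of [X^m - 1], and a field has at most [m] of
    those. *)
Lemma mem_index_subgroup d m u :
  (0 < m)%N -> #|F| = (d * m).+1 -> index_subgroup d C -> (u \in C) = (u ^+ m == 1)%g.
Proof.
move=> m_gt0 cardF /eqP indexC.
have d_gt0 : (0 < d)%N by rewrite -indexC indexg_gt0.
have cardC : #|C| = m.
  apply/eqP; rewrite -(eqn_pmul2r d_gt0) -[X in (_ * X)%N]indexC Lagrange ?subsetT //.
  by rewrite card_finField_unit cardF mulnC.
have subC : C \subset [set v : {unit F} | (v ^+ m == 1)%g].
  by apply/subsetP => v vC; rewrite inE -cardC expg_cardG.
suff /eqP -> : (C : {set {unit F}}) == [set v | (v ^+ m == 1)%g] by rewrite inE.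
rewrite eqEcard subC cardC -(card_imset _ val_inj).
apply: leq_trans (card_unity_roots F m_gt0); apply/subset_leq_card/subsetP => x.
case/imsetP => v; rewrite inE => /eqP vm ->; rewrite inE -FinRing.val_unitX vm.
by rewrite FinRing.val_unit1.
Qed.

Lemma coset_in_translate (a : F) w L L' : a = val w -> coset C w = (L' * L^-1)%g ->
  [set a * x | x in coset_in L] = coset_in L'.
Proof.
move=> -> cw; apply/setP => y; apply/imsetP/imsetP => [[x /imsetP[u uL ->] ->]|[v vL' ->]].
  exists (w * u)%g => //; rewrite mem_coset_unit coset_unitM cw.
  by move: uL; rewrite mem_coset_unit => /eqP ->; rewrite mulgKV.
exists (val (w^-1 * v)%g).
  apply: imset_f; rewrite mem_coset_unit coset_unitM.
  move: vL'; rewrite mem_coset_unit => /eqP ->.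
  by rewrite coset_unitV cw invMg invgK -mulgA mulVg mulg1.
by rewrite -FinRing.val_unitM mulKVg.
Qed.
End Cosets.

Theorem theorem1p1p2 (d n : nat) (hd : (0 < d)%N) (hn : (0 < n)%N) :
  exists q1 : nat, (0 < q1)%N /\
    forall F : finFieldType, (q1 <= #|F|)%N -> #|F| = 1 %[mod d] ->
    forall c : 'I_n -> F, injective c ->
    forall C : {group {unit F}}, index_subgroup d C ->
    forall s : 'I_n -> coset_of C -> coset_of C,
    exists f : F -> F, first_order_cyclotomic d f /\
      forall (j : 'I_n) (K : coset_of C),
        [set f x + c j * x | x in coset_in K] = coset_in (s j K).
Proof.
case: d hd => // d0 _; exists (threshold d0 n); split=> // F qlarge qd c c_inj C Cd s.
have [m cardF] : exists m, #|F| = (d0.+1 * m).+1.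
  have q_gt0 : (0 < #|F|)%N := ltnW (finNzRing_gt1 F).
  have : (d0.+1 %| #|F| - 1)%N by rewrite -eqn_mod_dvd //; apply/eqP.
  by case/dvdnP=> m mE; exists m; rewrite mulnC -mE subn1 prednK.
have m_gt0 : (0 < m)%N by move: (finNzRing_gt1 F); rewrite cardF; case: (m) => //; rewrite muln0.
(* A unit in the coset [s j K * K^-1]; [a K + c j] lies in the same coset as soon as its [m]-th
   power agrees with that of [t j K]. *)
pose t j K : {unit F} := (repr (s j K) * (repr K)^-1)%g.
have /fin_all_exists[a aP] : forall K, exists x, forall j, (x + c j) ^+ m = val (t j K) ^+ m.
  move=> K; apply: (exists_point qlarge cardF c_inj) => j.
  rewrite -exprM mulnC -FinRing.val_unitX -FinRing.val_unit1; congr val.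
  have -> : (d0.+1 * m)%N = #|[set: {unit F}]| by rewrite card_finField_unit cardF.
  by rewrite expg_cardG ?inE.
(* At [x = 0] the default unit 1 selects some coefficient, which the factor [x] annihilates. *)
pose f (x : F) := a (coset C (insubd (1%g : {unit F}) x)) * x.
have fE K : {in coset_in K, forall x, f x = a K * x}.
  move=> _ /imsetP[u uK ->]; rewrite /f valKd.
  by move: uK; rewrite mem_coset_unit => /eqP ->.
exists f; split; first split; first by rewrite /f mulr0.
  by exists C => // K; exists (a K); apply: fE.
(* If [a K + c j] were zero, its [m]-th power could not equal that of a unit, as [m > 0]. *)
move=> j K; have ac_unit : a K + c j \is a GRing.unit.
  rewrite unitfE; apply: contraTneq isT => ac0.
  have := aP K j; rewrite ac0 expr0n -[(m == 0)%N]negbK -lt0n m_gt0 => /esym/eqP.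
  by rewrite expf_eq0 m_gt0 /= => /eqP t0; have := valP (t j K); rewrite /= unitfE t0 eqxx.
transitivity [set (a K + c j) * x | x in coset_in K].
  by apply: eq_in_imset => x xK /=; rewrite (fE K) // mulrDl.
apply: (coset_in_translate (w := FinRing.unit F ac_unit)) => //.
have -> : (s j K * K^-1)%g = coset C (t j K).
  by rewrite coset_unitM coset_unitV !coset_reprK.
apply/eqP; rewrite eq_mulgV1 -?coset_unitV -coset_unitM.
apply/eqP/coset_id; rewrite (mem_index_subgroup _ m_gt0 cardF Cd).
have wt : (FinRing.unit F ac_unit ^+ m = t j K ^+ m)%g.
  by apply: val_inj; rewrite !FinRing.val_unitX; apply: aP.
rewrite expgMn ?expgVn ?wt ?mulgV //.
by apply: val_inj; apply: mulrC.
Qed.
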